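(* Let $N\ge1$ be an integer, $\sigma\ge0$, let $X_1,\dots,X_N$ be i.i.d. with distribution $\mathcal N(0,\sigma^2)$, and let $X=\sum_{i=1}^N|X_i|$. Then for every $\delta\ge0$, $$\Pr\big[X>(1+\delta)\,\mathbb E[X]\big]\le\exp\Big(-N\frac{\delta^2}{\pi}\Big).$$ *)

(* Defs.v *)
From HB Require Import structures.
From mathcomp Require Export all_boot all_order all_algebra.
From mathcomp Require Export all_classical all_reals all_analysis.

Set Implicit Arguments.
Unset Strict Implicit.
Unset Printing Implicit Defensive.

Export Order.TTheory GRing.Theory Num.Theory.
Export numFieldNormedType.Exports.

Local Open Scope classical_set_scope.
Local Open Scope ring_scope.

(* [s] is the standard deviation. The case split is needed because the
   library's [normal_prob m 0] is a placeholder (the uniform law on [0, 1])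
   and not the degenerate normal law N(m, 0), which is the Dirac mass at m. *)
Definition gaussian_law (R : realType) (m s : R) : set R -> \bar R :=
  if s == 0 then \d_m else normal_prob m s.

(* The laws are compared on measurable sets only: the set functions have no
   meaning elsewhere. *)
Definition has_law d d' (T : measurableType d) (T' : measurableType d')
    (R : realType) (P : probability T R) (X : {RV P >-> T'})
    (mu : set T' -> \bar R) : Prop :=
  forall A : set T', measurable A -> distribution P X A = mu A.

Definition mutually_independent d d' (T : measurableType d)
    (T' : measurableType d') (R : realType) (P : probability T R)
    (I : finType) (X : I -> {RV P >-> T'}) : Prop :=
  forall (J : {set I}) (A : I -> set T'),
    (forall i, i \in J -> measurable (A i)) ->
    P (\bigcap_(i in [set` J]) X i @^-1` A i)
    = (\prod_(i in J) P (X i @^-1` A i))%E.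

Definition iid d d' (T : measurableType d) (T' : measurableType d')
    (R : realType) (P : probability T R) (I : finType)
    (X : I -> {RV P >-> T'}) (mu : set T' -> \bar R) : Prop :=
  mutually_independent X /\ forall i, has_law (X i) mu.

(* Main.v *)
From HB Require Import structures.
Require Import Defs.
From mathcomp Require Import measurable_realfun.
From mathcomp Require Import ring lra.

(* Write [mu = sigma * sqrt (2 / pi)] for the mean of [|X_i|]. Tilting the
   Gaussian density by [exp (t x)] moves its mean to [sigma^2 t], so that
   [E exp (t |X_i|) = 2 exp (sigma^2 t^2 / 2) Pr[sigma^2 t + X_i >= 0]]. The
   last probability is at most [1/2] plus the length [sigma^2 t] times the
   maximum of the density, so the right-hand side is at most
   [exp (sigma^2 t^2 / 2) (1 + mu t) <= exp (mu t + sigma^2 t^2 / 2)]: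
   the variable [|X_i| - mu] is subgaussian with variance proxy [sigma^2].
   Chernoff's bound at [t = mu delta / sigma^2] concludes. *)

Set Implicit Arguments.
Unset Strict Implicit.
Unset Printing Implicit Defensive.

Local Open Scope classical_set_scope.
Local Open Scope ring_scope.

Lemma lee_prod (R : realDomainType) (I : Type) (r : seq I) (p : pred I)
    (f g : I -> \bar R) :
  (forall i, p i -> 0 <= f i <= g i)%E ->
  (\prod_(i <- r | p i) f i <= \prod_(i <- r | p i) g i)%E.
Proof.
(* Nonnegativity of the partial product is carried through the induction: multiplying two
   inequalities requires it. *)
move=> fg; suff /andP[] : (0 <= \prod_(i <- r | p i) f i
    <= \prod_(i <- r | p i) g i)%E by [].
elim/big_rec2: _ => [|i x y /fg /andP[f0 fgi] /andP[x0 xy]].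
  by rewrite lexx lee01.
by rewrite mule_ge0// lee_pmul.
Qed.

(** * Change of variables for a weighted measure *)

Section weighted_transfer.
Local Open Scope ereal_scope.
Context d d' (T : measurableType d) (T' : measurableType d') (R : realType).
Variables (mu : {measure set T -> \bar R}) (nu : {measure set T' -> \bar R}).
Variables (phi : {mfun T >-> T'}) (g : T -> R) (c : \bar R).
Hypotheses (mg : measurable_fun [set: T] g) (g0 : forall x, (0 <= g x)%R).
Hypothesis c0 : 0 <= c.
Hypothesis mu_nu : forall A : set T', measurable A ->
  \int[mu]_(x in phi @^-1` A) (g x)%:E = c * nu A.

Import HBNNSimple.

(** Both sides split over the level sets of [f], and [mu_nu] applies to each of them. *)
Let sfun_transfer (f : {nnsfun T' >-> R}) :
  \int[mu]_x ((f (phi x))%:E * (g x)%:E) = c * \int[nu]_y (f y)%:E.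
Proof.
have mA k : measurable (phi @^-1` (f @^-1` [set k])).
  exact: measurable_funPTI.
have g0' x : 0 <= (g x)%:E by rewrite lee_fin.
transitivity (\sum_(k \in range f)
    \int[mu]_x (k%:E * ((g x)%:E * (\1_(phi @^-1` (f @^-1` [set k])) x)%:E))).
  under eq_integral => x _.
    rewrite fimfunE -fsumEFin// ge0_mule_fsuml//; last first.
      by move=> k; rewrite nnfun_muleindic_ge0.
    over.
  rewrite ge0_integral_fsum//.
  - apply: eq_fsbigr => k _; apply: eq_integral => x _.
    by rewrite EFinM -muleA (muleC (g x)%:E).
  - move=> k; under eq_fun do rewrite -EFinM.
    apply/measurable_EFinP; apply: measurable_funM => //.
    apply: measurable_funM => //.
    exact: (measurable_indic (mA k)).
  - by move=> k x _; rewrite mule_ge0// nnfun_muleindic_ge0.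
under eq_integral do rewrite fimfunE -fsumEFin//.
rewrite ge0_integral_fsum//; last 2 first.
  by move=> k; exact/measurable_EFinP/measurable_funM.
  by move=> k x _; rewrite nnfun_muleindic_ge0.
rewrite ge0_mule_fsumr; last first.
  by move=> k; apply: integral_ge0 => x _; rewrite nnfun_muleindic_ge0.
apply: eq_fsbigr => k; rewrite inE => -[y _ fyk].
have k0 : 0 <= k%:E by rewrite -fyk lee_fin.
rewrite integralZl_indic_nnsfun// integral_indic// setIT muleCA.
rewrite ge0_integralZl//=.
- by rewrite -mu_nu// [in RHS]integral_mkcond epatch_indic.
- under eq_fun do rewrite -EFinM.
  by apply/measurable_EFinP/measurable_funM.
- by move=> x _; rewrite mule_ge0// lee_fin.
Qed.

(** Simple functions and monotone convergence on both sides extend [mu_nu] from sets to functions.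
    It serves twice: to free one factor of a product of independent variables, and to replace a
    normal law by its density. *)
Lemma ge0_integral_weighted_transfer (f : T' -> \bar R) :
  measurable_fun [set: T'] f -> (forall y, 0 <= f y) ->
  \int[mu]_x (f (phi x) * (g x)%:E) = c * \int[nu]_y f y.
Proof.
move=> mf f0; pose f_ := nnsfun_approx measurableT mf.
have cf y : EFin \o f_^~ y @ \oo --> f y by exact: cvg_nnsfun_approx.
have g0' x : 0 <= (g x)%:E by rewrite lee_fin.
rewrite -ge0_integralZl//.
transitivity (limn (fun n => \int[mu]_x ((f_ n (phi x))%:E * (g x)%:E))).
  rewrite -monotone_convergence//.
  - apply: eq_integral => x _; apply/esym/cvg_lim => //.
    by apply: cvgeZr => //; exact: cf.
  - move=> n; under eq_fun do rewrite -EFinM.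
    apply/measurable_EFinP/measurable_funM => //.
    exact: measurableT_comp.
  - by move=> n x _; rewrite mule_ge0// lee_fin.
  - move=> x _ m n mn; rewrite lee_wpmul2r// lee_fin.
    exact/lefP/nd_nnsfun_approx.
under eq_fun do rewrite sfun_transfer.
transitivity (limn (fun n => \int[nu]_y (c * (f_ n y)%:E))).
  congr (limn _); apply/funext => n; rewrite ge0_integralZl//.
    exact/measurable_EFinP.
  by move=> y _; rewrite lee_fin.
rewrite -monotone_convergence//.
- apply: eq_integral => y _; apply/cvg_lim => //.
  case: (c) c0 => [r r0|_|//]; first by apply: cvgeZl => //; exact: cf.
  (* The product is not continuous at [(+oo, 0)]. *)
  have [fy0|fy0] := eqVneq (f y) 0; last first.
    apply: cvgeM; [|exact: cvg_cst|exact: cf].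
    by rewrite mule_def_infty_neq0.
  rewrite [X in X @ _ --> _](_ : _ = cst (+oo * f y)); first exact: cvg_cst.
  apply/funext => n /=; congr (+oo * _); apply/eqP; rewrite eq_le.
  apply/andP; split; first by rewrite /f_ nnsfun_approxE le_approx.
  by rewrite fy0 lee_fin.
- by move=> n; apply: measurable_funeM; exact/measurable_EFinP.
- by move=> n y _; rewrite mule_ge0// lee_fin.
- move=> y _ m n mn; rewrite lee_wpmul2l// lee_fin.
  exact/lefP/nd_nnsfun_approx.
Qed.

End weighted_transfer.

(** * Expectation of a product of independent variables *)

Lemma ge0_integral_prod_independent (d d' : measure_display)
    (T : measurableType d) (T' : measurableType d') (R : realType)
    (P : probability T R) (I : finType) (X : I -> {RV P >-> T'})
    (f : I -> T' -> R) :
  mutually_independent X ->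
  (forall i, measurable_fun [set: T'] (f i)) -> (forall i y, 0 <= f i y) ->
  (\int[P]_w (\prod_i f i (X i w))%:E = \prod_i \int[P]_w (f i (X i w))%:E)%E.
Proof.
move=> indX mf f0.
(* Measurable functions are allowed one index at a time, the functions at the
   indices outside [s] being indicators; the base case is the definition. *)
suff main (s : seq I) : forall f : I -> T' -> R,
    (forall i, measurable_fun [set: T'] (f i)) -> (forall i y, 0 <= f i y) ->
    (forall i, i \notin s -> exists2 A, measurable A & f i = \1_A) ->
    (\int[P]_w (\prod_i f i (X i w))%:E = \prod_i \int[P]_w (f i (X i w))%:E)%E.
  by apply: (main (enum I)) => // i; rewrite mem_enum.
elim: s => {f mf f0} [|i s IH] f mf f0 fs.
  have [A mA] : exists2 A, (forall i, measurable (A i)) & f = fun i => \1_(A i).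
    have /choice[A hA] i : exists A, measurable A /\ f i = \1_A.
      by have [//|A ? ?] := fs i; exists A.
    by exists A; [move=> i; have [] := hA i|apply/funext => i; have [] := hA i].
  move=> ->.
  have mXA i : measurable (X i @^-1` A i) by exact: measurable_funPTI.
  pose B := \bigcap_(i in [set` [set: I]%SET]) X i @^-1` A i.
  transitivity (\int[P]_w (\1_B w)%:E)%E.
    apply: eq_integral => w _; congr (_%:E).
    rewrite indicE; case: (boolP (_ \in _)) => [|].
      rewrite inE => h; rewrite big1// => i _; rewrite indicE mem_set//.
      by apply: h => /=; rewrite inE.
    rewrite notin_setE => /existsNP[i /not_implyP[_ h]].
    by rewrite (bigD1 i)//= indicE memNset// mul0r.
  rewrite integral_indic//; last first.
    by apply: fin_bigcap_measurable => // i _; exact: mXA.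
  rewrite setIT.
  transitivity (\prod_(i in [set: I]%SET) P (X i @^-1` A i))%E.
    exact: indX.
  apply: eq_big => [i|i _]; first by rewrite inE.
  by rewrite (@integral_indic _ _ _ P _ _ (X i @^-1` A i))// setIT.
(* To free the index [i], the other factors become a weight [g]: the image under [X i] of the
   measure with density [g] is [c] times the law of [X i]. *)
pose g w := \prod_(j | j != i) f j (X j w).
pose c := (\prod_(j | j != i) \int[P]_w (f j (X j w))%:E)%E.
have mfX j : measurable_fun [set: T] (fun w => f j (X j w)).
  exact: (measurableT_comp (mf j)).
have mg : measurable_fun [set: T] g.
  rewrite /g; under eq_fun do rewrite -big_filter.
  exact: measurable_prod.
have g0 w : 0 <= g w by exact: prodr_ge0.
have c0 : (0 <= c)%E.
  by apply: prode_ge0 => j _; apply: integral_ge0 => w _; rewrite lee_fin.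
have transfer A : measurable A ->
    (\int[P]_(w in X i @^-1` A) (g w)%:E = c * distribution P (X i) A)%E.
  (* With an indicator at [i], every index outside [s] carries an indicator, so the induction
     hypothesis applies to [h]. *)
  move=> mA; pose h j := if j == i then \1_A : T' -> R else f j.
  have -> : (\int[P]_(w in X i @^-1` A) (g w)%:E =
             \int[P]_w (\prod_j h j (X j w))%:E)%E.
    rewrite integral_mkcond epatch_indic; apply: eq_integral => w _ /=.
    rewrite (bigD1 i)//= /h eqxx -EFinM mulrC; congr (_ * _)%:E.
    by apply: eq_bigr => j /negbTE ->.
  rewrite IH; first last.
  - move=> j js; rewrite /h; case: ifPn => [_|ji]; first by exists A.
    by apply: fs; rewrite inE negb_or ji.
  - by move=> j y; rewrite /h; case: ifPn => // _; rewrite indicE.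
  - by move=> j; rewrite /h; case: ifPn => // _; exact: measurable_indic.
  rewrite (bigD1 i)//= muleC; congr (_ * _)%E.
    by apply: eq_bigr => j /negbTE ji; rewrite /h ji.
  rewrite /h eqxx (@integral_indic _ _ _ P _ _ (X i @^-1` A)) ?setIT//.
  exact: measurable_funPTI.
have mfi : measurable_fun [set: T'] (EFin \o f i) by exact/measurable_EFinP.
have fi0 y : (0 <= (EFin \o f i) y)%E by rewrite lee_fin.
rewrite [RHS](bigD1 i)//= -/c muleC.
rewrite -[X in (_ * X)%E](ge0_integral_distribution (X i) mfi fi0).
rewrite -(ge0_integral_weighted_transfer mg g0 c0 transfer mfi fi0).
by apply: eq_integral => w _; rewrite (bigD1 i)//= EFinM.
Qed.

(** * Integrals against the Gaussian density *)

Section gaussian.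
Context (R : realType).
Implicit Types (m s t x : R).
Notation mu := (@lebesgue_measure R).

(* [normal_prob] lives on [measurableTypeR R], whose measurable structure has
   another display than that of [R], where the laws live: the two types are
   related by the identity [id_R]. *)
Lemma ge0_integral_normal_law (d : measure_display) (T : measurableType d)
    (P : probability T R) (X : {RV P >-> R}) m s (f : R -> R) :
  has_law X (normal_prob m s) ->
  measurable_fun [set: R] f -> (forall x, 0 <= f x) ->
  (\int[P]_w (f (X w))%:E = \int[mu]_x (f x * normal_pdf m s x)%:E)%E.
Proof.
move=> lawX mf f0.
have mf' : measurable_fun [set: R] (EFin \o f) by exact/measurable_EFinP.
have f0' x : (0 <= (EFin \o f) x)%E by rewrite lee_fin.
rewrite -[LHS](ge0_integral_distribution X mf' f0').
pose id_R : measurableTypeR R -> R := idfun.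
have mid : measurable_fun setT id_R := @measurable_id _ _ setT.
pose phi : {mfun measurableTypeR R >-> R} :=
  HB.pack id_R (isMeasurableFun.Build _ _ _ _ _ mid).
rewrite -[LHS]mul1e -(@ge0_integral_weighted_transfer _ _ _ _ _ mu
  (distribution P X) phi _ _ (measurable_normal_pdf m s) (normal_pdf_ge0 m s)
  lee01)//.
by move=> A mA; rewrite mul1e; exact/esym/lawX.
Qed.

Lemma normal_pdf0_sym s x : s != 0 -> normal_pdf 0 s (- x) = normal_pdf 0 s x.
Proof. by move=> s0; rewrite !normal_pdfE// /normal_fun !subr0 sqrrN. Qed.

Lemma normal_pdf_shift m s x : s != 0 ->
  normal_pdf m s (x + m) = normal_pdf 0 s x.
Proof.
by move=> s0; rewrite !normal_pdfE// (normal_fun_center m)/= addrK.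
Qed.

Lemma integral_normal_pdf_half s : s != 0 ->
  (\int[mu]_(x in `[0%R, +oo[) (normal_pdf 0 s x)%:E = 2^-1%:E)%E.
Proof.
move=> s0; have := integral_normal_pdf 0 s.
rewrite ge0_symfun_integralT.
- rewrite -set_itvcy => h.
  by rewrite -[RHS]mule1 -h muleA -EFinM mulVf ?pnatr_eq0// mul1e.
- exact: normal_pdf_ge0.
- exact: continuous_normal_pdf.
- by move=> x /=; rewrite normal_pdf0_sym.
Qed.

(** The translation by [m] reduces this to the centred density. *)
Lemma integral_normal_pdf_upper_half m s : s != 0 ->
  (\int[mu]_(x in `[m, +oo[) (normal_pdf m s x)%:E = 2^-1%:E)%E.
Proof.
move=> s0; rewrite -(integral_normal_pdf_half s0).
pose F (x : R^o) : R^o := x + m.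
have dF : (F^`())%classic = cst 1.
  apply/funext => x.
  by rewrite derive1E /F deriveD// derive_id derive_cst addr0.
have := @increasing_ge0_integration_by_substitutiony R F (normal_pdf m s) 0.
rewrite (_ : F 0 = m) ?/F ?add0r// -/F => ->.
- by apply: eq_integral => x _; rewrite !fctE/= dF mulr1 normal_pdf_shift.
- by move=> x y _ _; rewrite ltrD2r.
- by move=> x _; rewrite dF; exact: cvg_cst.
- by rewrite dF; exact: is_cvg_cst.
- by rewrite dF; exact: is_cvg_cst.
- split=> //; apply: cvg_at_right_filter; apply: cvgD => //; exact: cvg_cst.
- exact: cvg_addrr.
- exact/continuous_subspaceT/continuous_normal_pdf.
- by move=> x _; exact: normal_pdf_ge0.
Qed.

(** The half-line is cut at [m]: half of the mass lies above, and below the density is at most its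
    peak on a length [m]. *)
Lemma integral_normal_pdf_pos_le m s : s != 0 -> 0 <= m ->
  (\int[mu]_(x in `[0%R, +oo[) (normal_pdf m s x)%:E
   <= (2^-1 + m * normal_peak s)%:E)%E.
Proof.
move=> s0 m0.
have mpdf (D : set R) : measurable_fun D (fun x => (normal_pdf m s x)%:E).
  apply/measurable_EFinP; apply: measurable_funTS; exact: measurable_normal_pdf.
rewrite (@itv_bndbnd_setU _ _ _ (BLeft m))//.
rewrite ge0_integral_setU//=.
- rewrite integral_normal_pdf_upper_half// EFinD addeC leeD//.
  apply: (@le_trans _ _ (\int[mu]_(x in `[0%R, m[) (normal_peak s)%:E)%E).
    apply: ge0_le_integral => //.
    - by move=> x _; rewrite lee_fin normal_pdf_ge0.
    - exact: mpdf.
    - by move=> x _; rewrite lee_fin normal_pdf_ub.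
  rewrite integral_cst//= lebesgue_measure_itv/= lte_fin.
  case: ifPn => [_|]; first by rewrite oppr0 adde0 muleC.
  by move=> _; rewrite mule0 lee_fin mulr_ge0// normal_peak_ge0.
- exact: mpdf.
- by move=> x _; rewrite lee_fin normal_pdf_ge0.
- apply/disj_setPS => x [] /=; rewrite !in_itv/= andbT => /andP[_ xm].
  by move=> /(lt_le_trans xm); rewrite ltxx.
Qed.

(** This is [|s| sqrt (2 / pi)]. Written with the peak, it matches both the value at [0] of the
    antiderivative used for the mean and the linear term of the exponential moment. *)
Definition normal_abs_mean s := 2 * s ^+ 2 * normal_peak s.

(** By evenness this is twice the integral over the positive half-line, where [x * normal_pdf 0 s x]
    has the antiderivative [- s ^+ 2 * normal_pdf 0 s x], which vanishes at infinity. *)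
Lemma integral_normal_abs s : s != 0 ->
  (\int[mu]_x (`|x| * normal_pdf 0 s x)%:E = (normal_abs_mean s)%:E)%E.
Proof.
move=> s0; rewrite ge0_symfun_integralT//=.
- rewrite -set_itvcy (eq_integral
    (fun x : measurableTypeR R => (x * normal_pdf 0 s x)%:E)); last first.
    by move=> x; rewrite inE/= in_itv/= andbT => x0; rewrite ger0_norm.
  pose F (x : R^o) : R^o := - s ^+ 2 * normal_pdf 0 s x.
  have dF x : is_derive x 1 F (x * normal_pdf 0 s x).
    rewrite /F normal_pdfE// /normal_fun.
    by apply: is_derive_eq; rewrite /GRing.scale/=; field.
  rewrite (@ge0_continuous_FTC2y R _ F 0 0).
  + rewrite /F normal_pdfE// /normal_fun subrr expr0n/= oppr0 mul0r expR0 mulr1.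
    by rewrite /normal_abs_mean -EFinD -EFinM; congr EFin; ring.
  + by move=> x x0; rewrite mulr_ge0// normal_pdf_ge0.
  + apply: continuous_subspaceT => x; apply: cvgM; first exact: cvg_id.
    exact: continuous_normal_pdf.
  + rewrite /F normal_pdfE// -[X in _ --> X](mulr0 (- s ^+ 2)).
    apply: cvgM; first exact: cvg_cst.
    rewrite -[X in _ --> X](mulr0 (normal_peak s)).
    apply: cvgM; first exact: cvg_cst.
    have -> : normal_fun 0 s =
        (fun x => expR (- x)) \o (fun x => x ^+ 2 / (s ^+ 2 *+ 2)).
      by apply/funext => x; rewrite /normal_fun /= subr0 mulNr.
    apply: cvg_comp; last exact: cvgr_expR.
    apply: gt0_cvgMly; last exact: cvgr_expr2.
    by rewrite invr_gt0 mulrn_wgt0// exprn_even_gt0.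
  + by move=> x _; case: (dF x).
  + apply: cvg_at_right_filter; apply: cvgM; first exact: cvg_cst.
    exact: continuous_normal_pdf.
  + by move=> x _; rewrite derive1E; apply: derive_val.
- by move=> x; rewrite mulr_ge0// normal_pdf_ge0.
- move=> x; apply: cvgM; first exact: norm_continuous.
  exact: continuous_normal_pdf.
- by move=> x /=; rewrite normrN normal_pdf0_sym.
Qed.

(** Completing the square: [t x - x^2 / (2 s^2) = s^2 t^2 / 2 - (x - s^2 t)^2 / (2 s^2)]. *)
Lemma normal_pdf_tilt s t x : s != 0 ->
  expR (t * x) * normal_pdf 0 s x
  = expR (s ^+ 2 * t ^+ 2 / 2) * normal_pdf (s ^+ 2 * t) s x.
Proof.
move=> s0; rewrite !normal_pdfE// mulrCA [RHS]mulrCA; congr (_ * _).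
rewrite /normal_fun -!expRD; congr expR.
by field.
Qed.

Lemma integral_normal_expR_abs_le s t : s != 0 -> 0 <= t ->
  (\int[mu]_x (expR (t * `|x|) * normal_pdf 0 s x)%:E
   <= (expR (t * normal_abs_mean s + s ^+ 2 * t ^+ 2 / 2))%:E)%E.
Proof.
move=> s0 t0; rewrite ge0_symfun_integralT//=.
- rewrite -set_itvcy.
  rewrite (eq_integral
    (fun x : measurableTypeR R => (expR (s ^+ 2 * t ^+ 2 / 2))%:E
    * (normal_pdf (s ^+ 2 * t) s x)%:E)%E); last first.
    move=> x; rewrite inE/= in_itv/= andbT => x0.
    by rewrite ger0_norm// -EFinM normal_pdf_tilt.
  rewrite ge0_integralZl//=; last 2 first.
    apply/measurable_EFinP; apply: measurable_funTS.
    exact: measurable_normal_pdf.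
    by move=> x _; rewrite lee_fin normal_pdf_ge0.
  rewrite muleCA [t * _ + _]addrC expRD EFinM.
  rewrite lee_wpmul2l// ?lee_fin ?expR_ge0//.
  (* The factor [2] comes from evenness; the product is exactly [1 + t * normal_abs_mean s], which
     [1 + u <= exp u] then bounds. *)
  apply: (@le_trans _ _ (2%:E * (2^-1 + s ^+ 2 * t * normal_peak s)%:E)%E).
    by rewrite lee_wpmul2l// integral_normal_pdf_pos_le// mulr_ge0// sqr_ge0.
  rewrite -EFinM lee_fin; apply: le_trans (expR_ge1Dx _).
  by rewrite /normal_abs_mean; lra.
- by move=> x; rewrite mulr_ge0 ?expR_ge0 ?normal_pdf_ge0.
- move=> x; apply: cvgM; last exact: continuous_normal_pdf.
  apply: (@continuous_comp _ _ _ (fun x : R => t * `|x|) expR); last first.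
    exact: continuous_expR.
  by apply: cvgM; [exact: cvg_cst|exact: norm_continuous].
- by move=> x /=; rewrite normrN normal_pdf0_sym.
Qed.

(** This is where the constant [pi] of the final exponent comes from. *)
Lemma sqr_normal_abs_mean s : s != 0 ->
  normal_abs_mean s ^+ 2 = 2 * s ^+ 2 / pi.
Proof.
move=> s0; rewrite /normal_abs_mean /normal_peak exprMn exprVn.
rewrite sqr_sqrtr; last first.
  by rewrite mulrn_wge0// mulr_ge0 ?sqr_ge0 ?pi_ge0.
have : (pi : R) != 0 by rewrite gt_eqF// pi_gt0.
by move: (pi : R) => p p0; field; rewrite p0.
Qed.

End gaussian.

(** * The tail bound by Chernoff's method *)

Theorem theoremA1 (R : realType) (d : measure_display) (T : measurableType d)
    (P : probability T R) (N : nat) (hN : (1 <= N)%N)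
    (sigma : R) (hsigma : 0 <= sigma)
    (X : 'I_N -> {RV P >-> R}) (hX : iid X (gaussian_law 0 sigma))
    (delta : R) (hdelta : 0 <= delta) :
  let S : T -> R := fun w => \sum_(i < N) `|X i w| in
  (P [set w | (1 + delta)%:E * 'E_P[S] < (S w)%:E]
   <= (expR (- (N%:R * (delta ^+ 2 / pi))))%:E)%E.
Proof.
case: hX => indX lawX; cbv zeta.
pose S : T -> R := fun w => \sum_(i < N) `|X i w|; rewrite -/S.
have S0 w : 0 <= S w by exact: sumr_ge0.
have mabs i : measurable_fun [set: T] (fun w => `|X i w|).
  by apply: measurableT_comp.
have mS : measurable_fun [set: T] S by exact: measurable_sum.
have mlt (b : \bar R) : measurable [set w | (b < (S w)%:E)%E].
  rewrite -[X in measurable X]setTI; apply: measurable_lte => //.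
  exact/measurable_EFinP.
(* In the degenerate case all [X i] vanish on the almost sure event [B]. There [S] is [0], which
   does not strictly exceed a nonnegative threshold, so the event lies in a null set. *)
have [sigma0|sigma0] := eqVneq sigma 0.
  have PX0 i : P (X i @^-1` [set 0]) = 1%E.
    rewrite -[LHS]/(distribution P (X i) [set 0]) lawX//.
    by rewrite /gaussian_law sigma0 eqxx /dirac indicE mem_set.
  pose B := \bigcap_(i in [set` [set: 'I_N]%SET]) X i @^-1` [set (0 : R)].
  have PB : P B = 1%E.
    transitivity (\prod_(i in [set: 'I_N]%SET) P (X i @^-1` [set 0%R]))%E.
      exact: (indX _ (fun=> [set 0])).
    by rewrite big1.
  have mB : measurable B.
    by apply: fin_bigcap_measurable => // i _; exact: measurable_funPTI.
  have PCB : P (~` B) = 0%E by rewrite probability_setC// PB subee.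
  apply: (@le_trans _ _ (P (~` B))); last by rewrite PCB lee_fin expR_ge0.
  apply: le_measure; rewrite ?inE//; first exact: measurableC.
  move=> w /= Sw Bw; move: Sw; rewrite /S big1 => [|i _]; last first.
    by rewrite (Bw i) ?normr0//= inE.
  rewrite ltNge mule_ge0//; first by rewrite lee_fin addr_ge0.
  exact: expectation_ge0.
have lawN i : has_law (X i) (normal_prob 0 sigma).
  by move=> A mA; rewrite lawX// /gaussian_law (negbTE sigma0).
pose mu := normal_abs_mean sigma.
have sigma2 : 0 < sigma ^+ 2 by rewrite exprn_even_gt0.
have mu_gt0 : 0 < mu.
  by rewrite mulr_gt0 ?normal_peak_gt0// mulr_gt0.
have ES : ('E_P[S] = (N%:R * mu)%:E)%E.
  rewrite unlock; under eq_integral do rewrite -sumEFin.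
  rewrite ge0_integral_sum//; last by move=> i; exact/measurable_EFinP.
  transitivity (\sum_(i < N) mu%:E)%E.
    apply: eq_bigr => i _; rewrite -(integral_normal_abs sigma0).
    exact: (ge0_integral_normal_law (lawN i) (f := Num.norm)).
  by rewrite sumEFin sumr_const card_ord mulr_natl.
(* Chernoff's bound is applied with [t > 0], hence with [delta > 0]; for [delta = 0] the claimed
   bound is [1]. *)
move: hdelta; rewrite le_eqVlt => /predU1P[<-|delta0].
  by rewrite expr0n/= mul0r mulr0 oppr0 expR0 probability_le1.
(* This is the minimizer of the exponent [N (sigma^2 t^2 / 2 - t mu delta)] reached below. *)
pose t := mu * delta / sigma ^+ 2.
have t0 : 0 < t by rewrite divr_gt0// mulr_gt0.
pose S' : {RV P >-> R} := HB.pack S (isMeasurableFun.Build _ _ _ _ _ mS).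
rewrite ES -EFinM; set a := (1 + delta) * _.
(* Chernoff's bound concerns the non-strict event, which contains the strict one. *)
apply: (@le_trans _ _ (P [set w | a <= S' w])).
  apply: le_measure; rewrite ?inE//.
    rewrite (_ : [set w | _] = S' @^-1` `[a, +oo[).
      exact: measurable_funPTI.
    by apply/seteqP; split=> w /=; rewrite in_itv/= andbT.
  by move=> w /=; rewrite lte_fin => /ltW.
apply: le_trans (chernoff S' a t0) _.
have mexp : measurable_fun [set: R] (fun x => expR (t * `|x|)).
  apply: measurableT_comp => //.
  by apply: measurable_funM => //; exact: measurableT_comp.
have -> : 'M_P S' t = (\prod_(i < N) \int[P]_w (expR (t * `|X i w|))%:E)%E.
  rewrite -(ge0_integral_prod_independent indX (fun=> mexp)) => [|i x].
    rewrite /mmt_gen_fun unlock; apply: eq_integral => w _.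
    by rewrite /= /S mulrC mulr_sumr expR_sum.
  exact: expR_ge0.
apply: (@le_trans _ _
  ((\prod_(i < N) (expR (t * mu + sigma ^+ 2 * t ^+ 2 / 2))%:E)
   * (expR (- (t * a)))%:E)%E).
  rewrite lee_wpmul2r ?lee_fin ?expR_ge0//.
  apply: lee_prod => i _; apply/andP; split.
    by apply: integral_ge0 => w _; rewrite lee_fin expR_ge0.
  rewrite (ge0_integral_normal_law (lawN i) mexp) => [|x]; last exact: expR_ge0.
  exact/integral_normal_expR_abs_le/ltW.
rewrite prodEFin -EFinM lee_fin prodr_const card_ord.
rewrite -expRM_natl -expRD ler_expR.
have mu2 := sqr_normal_abs_mean sigma0.
(* At the chosen [t] the two exponents agree exactly, once [mu ^+ 2] is replaced by
   [2 * sigma ^+ 2 / pi]. *)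
rewrite le_eqVlt; apply/predU1P; left.
transitivity (- (N%:R * (mu ^+ 2 * delta ^+ 2 / (2 * sigma ^+ 2)))).
  by rewrite /t /a; field.
rewrite mu2.
have : (pi : R) != 0 by rewrite gt_eqF// pi_gt0.
by move: (pi : R) => p p0; field; rewrite p0.
Qed.
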